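(* Let $T$ be a nonspecial $\omega_1$-tree. Then $\diamondsuit_T$ implies $\diamondsuit$.
   Context: A tree is a partial order $(T,<_T)$ in which the set of predecessors of each node is well-ordered; every tree is assumed to have a root, denoted $\emptyset$. For $t\in T$, $t{\downarrow}=\{s\in T\mid s<_T t\}$, $\mathrm{ht}(t)$ is the order type of $t{\downarrow}$, and $T_\alpha$ is the set of nodes of height $\alpha$. The height of $T$ is the least $\alpha$ with $T_\alpha=\emptyset$. An $\omega_1$-tree is a tree of height $\omega_1$ all of whose levels $T_\alpha$ are countable. An antichain is a set of pairwise incomparable nodes. A set $U\subseteq T$ is special if it is a union of at most countably many antichains; otherwise it is nonspecial. For $X\subseteq T$, a map $f:X\to T$ is regressive if $f(t)<_T t$ for all $t\in X\setminus\{\emptyset\}$. For $T$ of height $\omega_1$, $NS^T$ is the ideal of all $B\subseteq T$ for which there is a regressive $f:B\to T$ such that $f^{-1}(\{t\})$ is special for every $t\in T$. For a nonspecial tree $T$ of height $\omega_1$, $\diamondsuit_T$ asserts that there is a sequence $(D_t\mid t\in T)$ with $D_t\subseteq t{\downarrow}$ for all $t\in T$ such that for every $X\subseteq T$, $\{t\in T\mid X\cap t{\downarrow}=D_t\}\notin NS^T$. $\diamondsuit$ is Jensen's principle: there is $(D_\alpha)_{\alpha<\omega_1}$ with $D_\alpha\subseteq\alpha$ such that for every $X\subseteq\omega_1$ the set $\{\alpha<\omega_1\mid X\cap\alpha=D_\alpha\}$ is stationary. *)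

(* Defs.v *)
From HB Require Import structures.
From mathcomp Require Import all_boot all_order.
From mathcomp Require Import all_classical.

Import Order.TTheory.
Local Open Scope order_scope.
Local Open Scope classical_set_scope.

Definition preds {d} {T : porderType d} (t : T) : set T := [set s | s < t].

(* The map is total on the ambient type, but only its restriction to [A]
   matters. *)
Definition order_iso {d d'} {T : porderType d} {U : porderType d'}
    (A : set T) (B : set U) : Prop :=
  exists f : T -> U, set_bij A B f /\
    forall x y, A x -> A y -> (f x <= f y) = (x <= y).

(* [W] has order type omega_1, i.e. it is the least uncountable ordinal up to
   isomorphism; its elements stand for the countable ordinals, and [preds a]
   for the ordinal [a] as the set of smaller ordinals. *)
Definition is_omega1 {d} (W : orderType d) : Prop :=
  [/\ wochoice.well_order (<=%O : rel W),
      ~ countable [set: W]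
    & forall a : W, countable (preds a)].

Definition unbounded {d} {W : orderType d} (C : set W) : Prop :=
  forall a, exists2 b, C b & a < b.

(* [a] is a nonzero limit ordinal and [C] is cofinal in it; if [a] is a
   successor, the second conjunct fails at its predecessor. *)
Definition limit_of {d} {W : orderType d} (C : set W) (a : W) : Prop :=
  preds a !=set0 /\ forall b, b < a -> exists2 c, C c & b < c < a.

Definition club {d} {W : orderType d} (C : set W) : Prop :=
  unbounded C /\ (forall a, limit_of C a -> C a).

Definition stationary {d} {W : orderType d} (S : set W) : Prop :=
  forall C : set W, club C -> S `&` C !=set0.

Definition diamond {d} (W : orderType d) : Prop :=
  exists D : W -> set W, (forall a, D a `<=` preds a) /\
    forall X : set W, stationary [set a | X `&` preds a = D a].

(* The root is the least element [\bot] of the [bPOrderType]. *)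
Definition is_tree {d} (T : bPOrderType d) : Prop :=
  forall t : T, wochoice.wo_chain (<=%O : rel T) [pred s | s < t].

(* The level T_a: the nodes [t] such that the order type of the predecessors
   of [t] is [a]. *)
Definition level {d d'} {W : orderType d} (T : bPOrderType d') (a : W) :
    set T :=
  [set t | order_iso (preds a) (preds t)].

(* The height of [T] is the order type of [W]: the levels below it are
   nonempty and no node has the order type of [W] as its height. *)
Definition has_height {d d'} (W : orderType d) (T : bPOrderType d') : Prop :=
  (forall a : W, level T a !=set0) /\
  ~ (exists t : T, order_iso [set: W] (preds t)).

Definition omega1_tree {d d'} (W : orderType d) (T : bPOrderType d') : Prop :=
  [/\ is_tree T, has_height W T & forall a : W, countable (level T a)].

Definition antichain {d} {T : porderType d} (A : set T) : Prop :=
  forall x y, A x -> A y -> x != y -> x >< y.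

(* The antichains may be empty, so this covers finite unions as well. *)
Definition special {d} {T : porderType d} (U : set T) : Prop :=
  exists A : nat -> set T,
    (forall n, antichain (A n)) /\ U = \bigcup_n A n.

(* A map X -> T is represented by a total map, of which only the values on
   [X] are used. *)
Definition regressive {d} {T : bPOrderType d} (X : set T) (f : T -> T) :
    Prop :=
  forall t, X t -> t != \bot -> f t < t.

Definition NS {d} {T : bPOrderType d} (B : set T) : Prop :=
  exists f : T -> T, regressive B f /\
    forall t, special (B `&` f @^-1` [set t]).

Definition diamond_tree {d} (T : bPOrderType d) : Prop :=
  exists D : T -> set T, (forall t, D t `<=` preds t) /\
    forall X : set T, ~ NS [set t | X `&` preds t = D t].

(* Main.v *)
(** Kunen's argument that countably many guesses per level suffice: the sets
    [rho @` D t], for [t] in level [a], are countably many guesses at [a].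
    Fix an injection [h : W -> nat -> W], and let the [n]-th candidate
    diamond sequence decode at [a], along [h ^~ n], the guess given by the
    [n]-th node of level [a]. If every candidate fails, at [X n] on the club
    [C n], code all the [X n] into one subset [Y] of [T]. Let [G] dominate [h]
    and choice functions for all the [C n]; then every nonzero [a] closed under
    [G] lies in each [C n], so a node guessing [Y] cannot have such a height.
    Hence each nonroot [t] guessing [Y] has a predecessor [s] with
    [rho t <= G (rho s)]. Mapping [t] to [s] is regressive with countable
    fibers, so the nodes guessing [Y] form a set in [NS]. *)

Require Import Defs.
From mathcomp Require Import all_boot all_order.
From mathcomp Require Import all_classical.

Import Order.TTheory.
Local Open Scope order_scope.
Local Open Scope classical_set_scope.

(** A least inaccessible predecessor of [t] would have only accessible predecessors. *)
Lemma wo_chain_preds_wf {d} {T : porderType d} :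
  (forall t : T, wochoice.wo_chain (<=%O : rel T) [pred s | s < t]) ->
  well_founded (fun s t : T => s < t).
Proof.
move=> wo; suff H (t s : T) : s < t -> Acc (fun s t : T => s < t) s.
  by move=> t; constructor => s; apply: H.
move=> st; apply: contrapT => nAs.
pose A := [pred s | (s < t) && `[< ~ Acc (fun s t : T => s < t) s >]].
have /(wo t) : {subset A <= [pred s | s < t]} by move=> x /andP[].
case; first by exists s; rewrite inE st; apply/asboolP.
move=> z [[/andP[zt /asboolP nAz] zmin] _]; apply: nAz.
constructor => y yz; apply: contrapT => nAy.
have /zmin : y \in A by rewrite inE (lt_trans yz zt); apply/asboolP.
by move=> zy; have := lt_le_trans yz zy; rewrite ltxx.
Qed.

Lemma well_order_wf {d} {W : orderType d} :
  wochoice.well_order (<=%O : rel W) -> well_founded (fun a b : W => a < b).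
Proof. by move=> wo; apply: wo_chain_preds_wf => t A _; apply: wo. Qed.

Lemma well_order_min {d} {W : orderType d} (A : set W) :
  wochoice.well_order (<=%O : rel W) -> A !=set0 ->
  exists2 a, A a & forall b, A b -> a <= b.
Proof.
move=> wo [x Ax]; have [|z [[zA zmin] _]] := wo [pred x | x \in A].
  by exists x; rewrite !inE.
exists z; first by move: zA; rewrite !inE.
by move=> b Ab; apply: zmin; rewrite !inE.
Qed.

(** Serves twice: for the starts of the blocks in [W], and for the rank of the nodes of a tree. *)
Lemma wf_image_rec {d} {T : porderType d} {Y : Type} (F : set Y -> Y) :
  well_founded (fun s t : T => s < t) ->
  exists f : T -> Y, forall t, f t = F (f @` preds t).
Proof.
move=> wf.
pose step t (rec : forall s : T, s < t -> Y) : Y :=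
  F [set y | exists s (st : s < t), rec s st = y].
exists (Fix wf (fun=> Y) step) => t.
rewrite Fix_eq; last first.
  move=> x f g fg; congr F; apply/seteqP.
  by split => y [s [sx <-]]; exists s, sx; rewrite fg.
congr F; apply/seteqP; split => y.
  by move=> [s [st <-]]; exists s.
by move=> [s st <-]; exists s, st.
Qed.

Lemma countable_special {d} {T : porderType d} (U : set T) :
  countable U -> special U.
Proof.
move=> /countable_injP[g gI]; exists (fun n => U `&` g @^-1` [set n]); split.
  move=> n x y [Ux /= gx] [Uy /= gy] /eqP []; apply: gI; rewrite ?inE //.
  by rewrite gx gy.
by apply/seteqP; split=> [x Ux|x [n _ []//]]; exists (g x).
Qed.

Section Omega1.
Context {d : Order.disp_t} {W : orderType d} (W1 : is_omega1 W).

Lemma omega1_inhabited : exists w : W, True.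
Proof.
case: W1 => _ nc _; apply: contrapT => nW; apply: nc.
rewrite (_ : [set: W] = set0) //; apply/seteqP; split => // x _.
by apply: nW; exists x.
Qed.

Lemma omega1_countable_le (b : W) : countable [set a | a <= b].
Proof.
case: W1 => _ _ /(_ b) cb.
apply: (@sub_countable _ _ _ (preds b `|` [set b])).
  by apply: subset_card_le => a /=; rewrite le_eqVlt => /orP[/eqP->|]; [right|left].
by rewrite -bigcup2E; apply: bigcup_countable => [|[|[|i]] _] //=.
Qed.

(** Otherwise [W] would be a countable union of countable initial segments. *)
Lemma omega1_countable_bounded (A : set W) :
  countable A -> exists b, forall a, A a -> a < b.
Proof.
move=> cA; have [_ nc _] := W1; apply: contrapT => nb; apply: nc.
apply: (@sub_countable _ _ _ (\bigcup_(a in A) [set b | b <= a])).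
  apply: subset_card_le => b _; apply: contrapT => nB; apply: nb.
  exists b => a Aa; rewrite ltNge; apply/negP => ba; apply: nB.
  by exists a.
by apply: bigcup_countable => // a _; apply: omega1_countable_le.
Qed.

(* Block [a] consists of the iterated successors of an element lying above
   all the blocks before [a]. *)
Lemma omega1_pair_inj : exists h : W -> nat -> W,
  forall a m b n, h a m = h b n -> a = b /\ m = n.
Proof.
have /choice[s sP] : forall a : W, exists b, a < b.
  move=> a.
  have [b /(_ a erefl) ab] := omega1_countable_bounded [set a] (countable1 a).
  by exists b.
(* Applied to the starts of the earlier blocks, [U] gives a bound on all of their elements; its
   value on uncountable sets is arbitrary. *)
have /choice[U UP] : forall A : set W, exists u, countable A ->
    forall a, A a -> forall n, iter n s a < u.
  move=> A; case: (EM (countable A)) => [cA|]; last first.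
    by have [w _] := omega1_inhabited; exists w.
  have [|b bP] := omega1_countable_bounded
      (\bigcup_n (fun a => iter n s a) @` A).
    apply: bigcup_countable => // n _; apply: sub_countable cA.
    exact: card_image_le.
  by exists b => _ a Aa n; apply: bP; exists n => //; exists a.
have [wo _ cW] := W1.
have [b bP] := wf_image_rec U (well_order_wf wo).
exists (fun a n => iter n s (b a)).
have smono x m n : (m < n)%N -> iter m s x < iter n s x.
  elim: n => // n IH; rewrite ltnS leq_eqVlt => /orP[/eqP->|/IH mn] /=.
    exact: sP.
  exact: lt_trans (sP _).
have block a a' m n : a < a' -> iter m s (b a) < iter n s (b a').
  move=> aa'; apply: (@lt_le_trans _ _ (b a')).
    rewrite (bP a'); apply: UP; last by exists a.
    exact: sub_countable (card_image_le _ _) (cW a').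
  by case: n => // n; apply/ltW/(smono _ 0%N).
move=> a m a' n; case: (ltgtP a a') => [lt|lt|<-] E.
- by move: (block _ _ m n lt); rewrite E ltxx.
- by move: (block _ _ n m lt); rewrite E ltxx.
split=> //; case: (ltngtP m n) => // lt.
- by move: (smono (b a) _ _ lt); rewrite E ltxx.
- by move: (smono (b a) _ _ lt); rewrite E ltxx.
Qed.

(** The rank is the Mostowski collapse: [rho t] is the least element of [W] that is not the rank of
    a predecessor of [t]. It maps [preds t] isomorphically onto [preds (rho t)], so its fibers lie
    within the countable levels. *)
Lemma omega1_tree_rank {d'} {T : bPOrderType d'} : omega1_tree W T ->
  exists rho : T -> W,
    [/\ forall s t, s < t -> rho s < rho t,
        forall t a, a < rho t -> exists2 s, s < t & rho s = a
      & forall a, countable (rho @^-1` [set a])].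
Proof.
move=> [Ttree [_ Tht] Tlev]; have [wo _ _] := W1.
have wf := wo_chain_preds_wf Ttree.
have /choice[F FP] : forall A : set W, exists w, A != setT ->
    ~ A w /\ forall a, a < w -> A a.
  move=> A; case: (eqVneq A setT) => [|/setTPn An].
    by have [w _] := omega1_inhabited; exists w.
  have [a nAa amin] := well_order_min (~` A) wo An.
  exists a => _; split => // b ba; apply: contrapT => /amin.
  by rewrite leNgt ba.
have [rho rhoE] := wf_image_rec F wf; exists rho.
(* Used with [B] all of [W], to contradict the height of [T], and with [B] equal to [preds (rho t)],
   to locate [t] in its level. *)
have iso (t : T) (B : set W) : rho @` preds t = B ->
    (forall s s', s < t -> s' < t -> s < s' -> rho s < rho s') ->
    order_iso B (preds t).
  move=> BE mono.
  have tot s s' : s < t -> s' < t -> (s <= s') || (s' <= s).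
    by apply: (wochoice.wo_chainW (Ttree t)).
  have le s s' : s < t -> s' < t -> (rho s <= rho s') = (s <= s').
    move=> st s't; apply/idP/idP; last first.
      by rewrite le_eqVlt => /orP[/eqP->//|/mono]; move=> /(_ st s't)/ltW.
    move=> rr; case/orP: (tot _ _ st s't) => //.
    rewrite le_eqVlt => /orP[/eqP->//|/mono] /(_ s't st).
    by rewrite ltNge rr.
  have /choice[g gP] : forall a, exists s, B a -> s < t /\ rho s = a.
    move=> a; case: (EM (B a)) => [|nB]; last by exists t.
    by rewrite -BE => -[s st <-]; exists s.
  exists g; split; last first.
    by move=> x y /gP[gx rx] /gP[gy ry]; rewrite -le // rx ry.
  split=> [x /gP[]//|x y|s st].
    by rewrite !inE => /gP[_ rx] /gP[_ ry] E; rewrite -rx E.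
  have /gP[gt rg] : B (rho s) by rewrite -BE; exists s.
  exists (rho s); first by rewrite -BE; exists s.
  by apply: le_anti; rewrite -!le // rg lexx.
have main t : (forall s, s < t -> rho s < rho t) /\ rho @` preds t = preds (rho t).
  elim/(well_founded_ind wf): t => t IH.
  have mono s s' : s < t -> s' < t -> s < s' -> rho s < rho s'.
    by move=> _ /IH[+ _] => /[apply].
  have nT : rho @` preds t != setT.
    by apply/eqP => E; apply: Tht; exists t; apply: iso.
  have [nF Flt] := FP _ nT; rewrite -rhoE in nF Flt.
  have lt s : s < t -> rho s < rho t.
    move=> st; rewrite ltNge le_eqVlt; apply/negP => /orP[/eqP E|rts].
      by apply: nF; rewrite E; exists s.
    (* By induction the ranks below [s] fill [preds (rho s)], so [rho t] would already be the rank
       of some [u < s]. *)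
    have [_ sE] := IH _ st.
    have : preds (rho s) (rho t) by [].
    by rewrite -sE => -[u us uE]; apply: nF; exists u => //; apply: lt_trans st.
  by split=> //; apply/seteqP; split => [_ [s /lt ? <-]//|a /Flt].
split.
- by move=> s t; apply: (main t).1.
- move=> t a; have [_ E] := main t.
  by move=> at_; have : preds (rho t) a by []; rewrite -E => -[s]; exists s.
move=> a; apply: sub_countable (Tlev a); apply: subset_card_le => t /= <-.
have [_ E] := main t; apply: iso => // s s' _ _; exact: (main s').1.
Qed.

End Omega1.

Theorem corollary3p5 (dW dT : Order.disp_t) (W : orderType dW)
    (T : bPOrderType dT) :
  is_omega1 W ->
  omega1_tree W T ->
  ~ special [set: T]%classic ->
  diamond_tree T ->
  diamond W.
Proof.
move=> W1 Tw1 _ [D [_ DP]]; apply: contrapT => nD.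
have [h hI] := omega1_pair_inj W1.
have [rho [rho_lt rho_ex rho_c]] := omega1_tree_rank W1 Tw1.
have [e eP] : exists e : W -> nat -> T, forall t, exists n, e (rho t) n = t.
  suff /choice[e eP] : forall a, exists e : nat -> T,
      forall t, rho t = a -> exists n, e n = t.
    by exists e => t; apply: eP.
  move=> a; have /countable_injP[g gI] := rho_c a.
  have /choice[e eP] : forall n, exists t, forall u, rho u = a -> g u = n -> u = t.
    move=> n; case: (EM (exists2 t, rho t = a & g t = n)) => [[t ta tn]|nt].
      by exists t => u ua un; apply: gI; rewrite ?inE // un tn.
    by exists \bot => u ua un; case: nt; exists u.
  by exists e => t ta; exists (g t); apply/esym/eP.
pose S n a := [set x | x < a /\ exists2 s, D (e a n) s & rho s = h x n].
have /choice[X XP] : forall n, exists X : set W, exists2 C, club C &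
    forall a, C a -> X `&` preds a <> S n a.
  move=> n; apply: contrapT => nX; apply: nD; exists (S n).
  split=> [a x []//|X C cC]; apply: contrapT => nC; apply: nX.
  by exists X, C => // a Ca E; apply: nC; exists a.
have /choice[C CP] : forall n, exists C, club C /\
    forall a, C a -> X n `&` preds a <> S n a.
  by move=> n; case: (XP n) => C ? ?; exists C.
have /choice[G GP] : forall x, exists b, forall n,
    h x n < b /\ exists2 c, C n c & x < c < b.
  move=> x; have /choice[c cP] : forall n, exists c, C n c /\ x < c.
    by move=> n; have [[/(_ x)[c]]] := CP n; exists c.
  have [|b bP] := omega1_countable_bounded W1 (range (h x) `|` range c).
    rewrite -bigcup2E; apply: bigcup_countable => [|[|[|i]] _] //=;
      exact: sub_countable (card_image_le _ _) _.
  exists b => n; split; first by apply: bP; left; exists n.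
  exists (c n); first exact: (cP n).1.
  by rewrite (cP n).2 /=; apply: bP; right; exists n.
(* Membership in [Y] depends on the rank alone, so any branch through level [h x n] records whether
   [X n x] holds. *)
pose Y := [set t : T | exists x n, X n x /\ h x n = rho t].
have GN (t : T) : Y `&` preds t = D t -> t != \bot ->
    exists2 s, s < t & rho t <= G (rho s).
  move=> Dt tN0; apply: contrapT => nG.
  have Gcl x : x < rho t -> G x < rho t.
    move=> xt; rewrite ltNge; apply/negP => Gx; apply: nG.
    by have [s st sx] := rho_ex _ _ xt; exists s; rewrite ?sx.
  (* With [n] the index of [t] in its own level, [S n (rho t)] decodes [D t] itself. *)
  have [n en] := eP t; have [[_ clC] nX] := CP n.
  apply: (nX (rho t)).
    apply: clC; split.
      by exists (rho \bot); apply: rho_lt; rewrite lt_neqAle eq_sym tN0 le0x.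
    move=> x xt; have [_ [c Cc /andP[xc cG]]] := GP x n.
    by exists c => //; rewrite xc (lt_trans cG (Gcl _ xt)).
  (* Closure under [G] puts a node of rank [h x n] below [t]; conversely, injectivity of [h]
     recovers [x] and [n] from that rank. *)
  rewrite /S en -Dt; apply/seteqP; split=> [x [Xx xt]|x [xt]] /=.
    split=> //; have [hG _] := GP x n.
    have [s st sx] := rho_ex _ _ (lt_trans hG (Gcl _ xt)).
    by exists s => //; split=> //; exists x, n.
  move=> [s [[y [m [Xy hy]]] _] sE]; split=> //.
  by move: hy; rewrite sE => /hI[<- <-].
apply: (DP Y).
have /choice[f fP] : forall t, exists s, Y `&` preds t = D t -> t != \bot ->
    s < t /\ rho t <= G (rho s).
  move=> t; case: (EM (exists2 s, s < t & rho t <= G (rho s))).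
    by move=> [s]; exists s.
  by move=> nG; exists t => ? ?; case: nG; apply: GN.
exists f; split=> [t Yt /(fP _ Yt)[]//|s].
apply: countable_special.
(* The root is added by hand because [fP] says nothing about it; the other nodes of the fiber have
   rank at most [G (rho s)]. *)
apply: (@sub_countable _ _ _
  ([set \bot] `|` \bigcup_(a in [set a | a <= G (rho s)]) rho @^-1` [set a])).
  apply: subset_card_le => t [Yt /= fts].
  have [->|tN0] := eqVneq t \bot; [by left|right].
  by exists (rho t) => //=; rewrite -fts; apply: (fP _ Yt tN0).2.
rewrite -bigcup2E; apply: bigcup_countable => [|[|[|i]] _] //=.
by apply: bigcup_countable => [|a _]; [exact: omega1_countable_le|].
Qed.
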